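(* Let $n\ge1$ be an integer, and let a society consist of $n$ egoists, the utility increments in a random proposal being independent random variables with the normal distribution with mean $\mu\in\mathbb{R}$ and standard deviation $\sigma>0$. Let $\rho=\mu/\sigma$, and let $F$ and $f$ denote the standard normal cumulative distribution function and density, respectively. Then $$\alpha_0=F(\rho)\left(1-\frac{\rho F(-\rho)}{f(\rho)}\right)$$ is an optimal majority/acceptance threshold, i.e. $\mathrm{E}(\eta_i(\alpha_0))\ge \mathrm{E}(\eta_i(\alpha))$ for every $\alpha\in[-\frac1n,1]$ and every $i\in\{1,\dots,n\}$.
   Context: Setting (ViSE model, society of $n$ egoists): a random proposal is a vector $\boldsymbol\zeta=(\zeta_1,\ldots,\zeta_n)$ of independent identically distributed real random variables; $\zeta_i$ is the proposed utility increment of agent $i$. Each agent votes for the proposal if and only if his/her own proposed increment is positive. For a relative voting threshold $\alpha\in[-\frac1n,1]$, the proposal is accepted if and only if $\#\{k:\zeta_k>0,\ k=1,\ldots,n\}>\alpha n$. The actual utility increments are $\eta_i(\alpha)=\zeta_i\, I(\boldsymbol\zeta,\alpha n)$, where $I(\boldsymbol\zeta,\alpha n)=1$ if $\#\{k:\zeta_k>0\}>\alpha n$ and $I(\boldsymbol\zeta,\alpha n)=0$ otherwise. A threshold in $[-\frac1n,1]$ is called optimal if it provides the highest possible expected utility increment $\mathrm{E}(\eta_i(\alpha))$ of an agent (this expectation does not depend on $i$); optimal thresholds are not unique. *)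

(* Defs.v *)
(* MathComp-Analysis, over an arbitrary [R : realType]. *)
From HB Require Import structures.
From mathcomp Require Import all_boot all_order all_algebra.
From mathcomp Require Import all_classical all_reals all_analysis.

Set Implicit Arguments.
Unset Strict Implicit.
Unset Printing Implicit Defensive.

Import Order.TTheory GRing.Theory Num.Theory.
Import numFieldNormedType.Exports.

Local Open Scope classical_set_scope.
Local Open Scope ring_scope.

Definition std_normal_pdf (R : realType) (x : R) : R := normal_pdf 0 1 x.

Definition std_normal_cdf (R : realType) (x : R) : R :=
  fine (normal_prob 0 1 `]-oo, x]).

(* Restricted to measurable sets: the values of [P] on non-measurable sets are
   unspecified, so a plain equality of set functions would be too strong. *)
Definition has_normal_distribution (d : measure_display) (T : measurableType d)
    (R : realType) (P : probability T R) (mu sigma : R) (X : {RV P >-> R}) :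
    Prop :=
  forall A : set R, measurable A ->
    distribution P X A = normal_prob mu sigma A.

Definition mutually_independent (d : measure_display) (T : measurableType d)
    (R : realType) (P : probability T R) (I : finType)
    (X : I -> {RV P >-> R}) : Prop :=
  forall (J : {set I}) (A : I -> set R), (forall i, measurable (A i)) ->
    P (\bigcap_(i in [set` J]) X i @^-1` A i) =
    (\prod_(i in J) P (X i @^-1` A i))%E.

Definition supporters (R : realType) (n : nat) (z : 'I_n -> R) : {set 'I_n} :=
  [set k : 'I_n | 0 < z k]%SET.

Definition acceptance (R : realType) (n : nat) (z : 'I_n -> R) (t : R) : R :=
  if t < #|supporters z|%:R then 1 else 0.

Definition actual_increment (R : realType) (T : Type) (n : nat)
    (zeta : 'I_n -> T -> R) (alpha : R) (i : 'I_n) (w : T) : R :=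
  zeta i w * acceptance (zeta^~ w) (alpha * n%:R).

Definition optimal_threshold (d : measure_display) (T : measurableType d)
    (R : realType) (P : probability T R) (n : nat) (zeta : 'I_n -> {RV P >-> R})
    (alpha0 : R) : Prop :=
  - n%:R^-1 <= alpha0 <= 1 /\
  forall alpha : R, - n%:R^-1 <= alpha <= 1 ->
  forall i : 'I_n,
    ('E_P[actual_increment zeta alpha i]
       <= 'E_P[actual_increment zeta alpha0 i])%E.

(* Main.v *)
Require Import Defs.
From HB Require Import structures.
From mathcomp Require Import all_boot all_order all_algebra.
From mathcomp Require Import all_classical all_reals all_analysis.
From mathcomp Require Import perm measurable_realfun ring lra.

Import Order.TTheory GRing.Theory Num.Theory.
Import numFieldNormedType.Exports.

Local Open Scope classical_set_scope.
Local Open Scope ring_scope.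

(** Let [p = F rho] and [q = F (- rho)] be the probabilities of a favourable and
    of an unfavourable vote, and let [g] and [- l] be the means of an increment
    conditioned on its sign. By independence, given that the set of supporters is
    [S], the increment of an agent has mean [g] inside [S] and [- l] outside
    ([integral_voting_event]), so that accepting [S] brings the whole society
    [#|S| * g - (n - #|S|) * l] on average. This is an increasing affine function
    of [#|S|], which vanishes at [n * l / (g + l)]. The agents being exchangeable,
    each of them gets one n-th of the collective gain, and the best rule accepts
    precisely the patterns whose collective gain is positive: the threshold
    [l / (g + l)] is optimal ([optimal_cut], [partial_means_optimal_threshold]).

    For normal increments, [- s ^+ 2] times the density is a primitive of
    [(x - m)] times the density, which gives [p * g = sigma * f rho + mu * p]
    ([normal_pos_part_mean]) and, by reflection, [q * l = sigma * f rho - mu * q]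
    ([normal_neg_part_mean]). As [p + q = 1], it follows that
    [g + l = sigma * f rho / (p * q)], and [l / (g + l)] is the announced
    threshold. *)

(** * First moments of a normal law over half-lines *)

Section normal_half_lines.
Context {R : realType}.
Local Notation leb := (@lebesgue_measure R).

Lemma is_derive_normal_pdf (m s x : R) : s != 0 ->
  is_derive x 1 (fun y => - s ^+ 2 * normal_pdf m s y)
    ((x - m) * normal_pdf m s x).
Proof.
move=> s0; rewrite normal_pdfE// /normal_fun.
by apply: is_derive_eq; rewrite /GRing.scale /=; field.
Qed.

Lemma normal_pdf_cvgy (m s : R) : s != 0 ->
  normal_pdf m s y @[y --> +oo] --> (0 : R).
Proof.
move=> s0; rewrite normal_pdfE// -(mulr0 (normal_peak s)).
apply: cvgM; first exact: cvg_cst.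
have -> : normal_fun m s =
    gauss_fun \o (fun y => (y - m) / Num.sqrt (s ^+ 2 *+ 2)).
  apply/funext => y /=; rewrite /gauss_fun /normal_fun; congr expR.
  by rewrite mulNr exprMn exprVn sqr_sqrtr// pmulrn_lge0// sqr_ge0.
apply: cvg_comp (@cvg_gauss_fun R).
apply/gt0_cvgMly; last exact: cvg_addrr.
by rewrite invr_gt0// sqrtr_gt0 -mulr_natr mulr_gt0// exprn_even_gt0.
Qed.

Lemma continuous_subr_normal_pdf (m s : R) : s != 0 ->
  continuous (fun x => (x - m) * normal_pdf m s x).
Proof.
move=> s0 x; apply: cvgM; last exact: continuous_normal_pdf.
by apply: cvgB => //; exact: cvg_cst.
Qed.

Lemma normal_pdf_primitive_continuous (m s : R) : s != 0 ->
  continuous (fun y => - s ^+ 2 * normal_pdf m s y).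
Proof.
by move=> s0 x; apply: cvgM; [exact: cvg_cst|exact: continuous_normal_pdf].
Qed.

Lemma integral_subr_normal_pdf_cbnd_mean (m s a : R) : s != 0 -> m <= a ->
  (\int[leb]_(x in `[a, +oo[) ((x - m) * normal_pdf m s x)%:E =
   (s ^+ 2 * normal_pdf m s a)%:E)%E.
Proof.
move=> s0 ma.
rewrite (@ge0_continuous_FTC2y _ _ (fun y => - s ^+ 2 * normal_pdf m s y) _ 0).
- by rewrite sub0e -EFinN mulNr opprK.
- by move=> x ax; rewrite mulr_ge0 ?normal_pdf_ge0// subr_ge0 (le_trans ma).
- exact/continuous_subspaceT/continuous_subr_normal_pdf.
- rewrite -[X in _ --> X](mulr0 (- s ^+ 2)); apply: cvgM; first exact: cvg_cst.
  exact: normal_pdf_cvgy.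
- by move=> x _; apply: ex_derive; exact: is_derive_normal_pdf.
- by apply: cvg_at_right_filter; exact: normal_pdf_primitive_continuous.
- move=> x _; rewrite derive1E; apply: derive_val.
  exact: is_derive_normal_pdf.
Qed.

Lemma integral_subr_normal_pdf_segment (m s a b : R) : s != 0 -> a < b ->
  (\int[leb]_(x in `[a, b]) ((x - m) * normal_pdf m s x)%:E =
   (s ^+ 2 * (normal_pdf m s a - normal_pdf m s b))%:E)%E.
Proof.
move=> s0 ab.
rewrite (@continuous_FTC2 _ _ (fun y => - s ^+ 2 * normal_pdf m s y)) //.
- by rewrite -EFinB; congr EFin; ring.
- exact/continuous_subspaceT/continuous_subr_normal_pdf.
- split.
  + by move=> x _; apply: ex_derive; exact: is_derive_normal_pdf.
  + by apply: cvg_at_right_filter; exact: normal_pdf_primitive_continuous.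
  + by apply: cvg_at_left_filter; exact: normal_pdf_primitive_continuous.
- move=> x _; rewrite derive1E; apply: derive_val.
  exact: is_derive_normal_pdf.
Qed.

(** The fundamental theorem of calculus on an unbounded interval is applied to
    an integrand of constant sign, and [(x - m) * normal_pdf m s x] changes sign
    at the mean; when [a < m] the half-line is therefore cut at [m]. *)
Lemma integral_subr_normal_pdf_cbnd (m s a : R) : s != 0 ->
  (\int[leb]_(x in `[a, +oo[) ((x - m) * normal_pdf m s x)%:E =
   (s ^+ 2 * normal_pdf m s a)%:E)%E.
Proof.
move=> s0.
have [am|ma] := ltP a m; last exact: integral_subr_normal_pdf_cbnd_mean.
have mg : measurable_fun setT (fun x : R => ((x - m) * normal_pdf m s x)%:E).
  apply/measurable_EFinP; apply: continuous_measurable_fun.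
  exact: continuous_subr_normal_pdf.
have -> : [set` `[a, +oo[%R] = [set` `[a, m]%R] `|` [set` `]m, +oo[%R].
  by rewrite -itv_bndbnd_setU// bnd_simp// ltW.
rewrite integral_setU//=; last 2 first.
- exact: measurable_funTS.
- apply/disj_setPS => x [] /=; rewrite !in_itv/= andbT => /andP[_ xm] mx.
  by move: (le_lt_trans xm mx); rewrite ltxx.
rewrite integral_itv_obnd_cbnd; last exact: measurable_funTS.
rewrite integral_subr_normal_pdf_cbnd_mean// integral_subr_normal_pdf_segment//.
by rewrite -EFinD; congr EFin; ring.
Qed.

(** A measurable real function whose integral is finite is integrable, so this
    follows from the value of the integral. *)
Lemma integrable_subr_normal_pdf_cbnd (m s a : R) : s != 0 ->
  leb.-integrable `[a, +oo[ (fun x : R => ((x - m) * normal_pdf m s x)%:E).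
Proof.
move=> s0.
have mg : measurable_fun `[a, +oo[
    (fun x : R => ((x - m) * normal_pdf m s x)%:E).
  apply/measurable_funTS/measurable_EFinP; apply: continuous_measurable_fun.
  exact: continuous_subr_normal_pdf.
apply/integrableP; split => //; apply/abse_integralP => //.
by rewrite integral_subr_normal_pdf_cbnd//= ltry.
Qed.

Lemma integral_id_normal_pdf_cbnd (m s a : R) : s != 0 ->
  (\int[leb]_(x in `[a, +oo[) (x * normal_pdf m s x)%:E =
   (s ^+ 2 * normal_pdf m s a)%:E + m%:E * normal_prob m s `[a, +oo[)%E.
Proof.
move=> s0; rewrite -(integral_subr_normal_pdf_cbnd _ _ _ s0).
have ip : leb.-integrable `[a, +oo[ (fun x => (normal_pdf m s x)%:E).
  by apply: integrableS (integrable_normal_pdf m s).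
rewrite /normal_prob -integralZl// -integralD//.
- by apply: eq_integral => x _; rewrite -EFinM -EFinD; congr EFin; ring.
- exact: integrable_subr_normal_pdf_cbnd.
- by apply: integrableZl.
Qed.

Lemma normal_pdf_std (m s x : R) : 0 < s ->
  normal_pdf m s x = s^-1 * std_normal_pdf ((m - x) / s).
Proof.
move=> s0; rewrite /std_normal_pdf !normal_pdfE ?oner_eq0 ?gt_eqF//.
rewrite mulrA; congr (_ * expR _).
  rewrite /normal_peak -invfM; congr (_^-1).
  rewrite -!mulrnAr sqrtrM ?sqr_ge0// sqrtr_sqr gtr0_norm//.
  by rewrite expr1n mul1r.
by field; rewrite gt_eqF.
Qed.

(** The substitution [y |-> (m - y) / s] is decreasing, which turns the upper
    half-line directly into the lower one that defines [std_normal_cdf]. *)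
Lemma normal_prob_cy (m s : R) : 0 < s ->
  normal_prob m s `[0, +oo[ = (std_normal_cdf (m / s))%:E.
Proof.
move=> s0; rewrite /std_normal_cdf fineK; last exact: fin_num_measure.
pose F (y : R) := (m - y) / s.
have F0 : F 0 = m / s by rewrite /F subr0.
have dF (x : R) : is_derive x 1 F (- s^-1).
  rewrite /F; apply: is_derive_eq; rewrite /GRing.scale/=.
  by rewrite mulr0 !add0r mul1r mulrN1.
have F' : derive1 F = cst (- s^-1).
  apply/funext => x.
  by rewrite derive1E (@derive_val _ _ _ _ _ _ _ (dF x)).
have cF : continuous F.
  move=> x; apply: differentiable_continuous; apply/derivable1_diffP.
  by apply: ex_derive.
rewrite /normal_prob -F0 decreasing_ge0_integration_by_substitutiony//.
- apply: eq_integral => x _; rewrite /= F'/=; congr EFin.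
  by rewrite opprK (normal_pdf_std _ _ _ s0) mulrC.
- move=> x y _ _ xy; rewrite /F ltr_pM2r ?invr_gt0//; lra.
- by rewrite F' => x _; exact: cvg_cst.
- by rewrite F'; exact: is_cvg_cst.
- by rewrite F'; exact: is_cvg_cst.
- split; first by move=> x _; apply: ex_derive.
  by apply: cvg_at_right_filter; exact: cF.
- rewrite /F; apply/gt0_cvgMlNy; first by rewrite invr_gt0.
  apply: (cvg_comp (@GRing.opp R) (fun y => m + y)).
    by apply/(@cvgNrNy _ _ _ _ id).
  exact: cvg_addrl_Ny.
- apply: continuous_subspaceT; apply: continuous_normal_pdf.
  exact: oner_neq0.
- by move=> x _; exact: normal_pdf_ge0.
Qed.

Lemma normal_pdfN (m s x : R) : s != 0 ->
  normal_pdf m s (- x) = normal_pdf (- m) s x.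
Proof.
move=> s0; rewrite !normal_pdfE//; congr *%R; congr expR; congr (_ / _).
by rewrite -opprD sqrrN opprK.
Qed.

Lemma normal_prob_Nyc (m s : R) : s != 0 ->
  normal_prob m s `]-oo, 0] = normal_prob (- m) s `[0, +oo[.
Proof.
move=> s0.
have := @ge0_integration_by_substitutionNy R (normal_pdf m s) 0.
rewrite /normal_prob oppr0 => ->.
- by apply: eq_integral => x _; rewrite /= normal_pdfN.
- by apply: continuous_subspaceT; apply: continuous_normal_pdf.
- by move=> x _; exact: normal_pdf_ge0.
Qed.

Lemma integral_id_normal_pdf_Nyc (m s : R) : s != 0 ->
  (\int[leb]_(x in `]-oo, 0%R]) (- x * normal_pdf m s x)%R%:E =
  \int[leb]_(x in `[0%R, +oo[) (x * normal_pdf (- m) s x)%:E)%E.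
Proof.
move=> s0.
have := @ge0_integration_by_substitutionNy R
  (fun x => - x * normal_pdf m s x) 0.
rewrite oppr0 => ->.
- by apply: eq_integral => x _; rewrite /= normal_pdfN// opprK.
- apply: continuous_subspaceT => x.
  by apply: cvgM; [apply: cvgN; exact: cvg_id|exact: continuous_normal_pdf].
- move=> x; rewrite in_itv/= => x0; rewrite mulr_ge0 ?normal_pdf_ge0// oppr_ge0.
  exact: ltW.
Qed.

Lemma sqr_normal_pdf0 (m s : R) : 0 < s ->
  s ^+ 2 * normal_pdf m s 0 = s * std_normal_pdf (m / s).
Proof.
by move=> s0; rewrite normal_pdf_std// subr0 mulrA expr2 mulfK// gt_eqF//.
Qed.

(** The density of [normal_prob m s] for the Lebesgue measure is almost
    everywhere its Radon-Nikodym derivative, for which the change of measure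
    holds. *)
Lemma ge0_integral_normal_prob (m s : R) (E : set R) (f : R -> \bar R) :
  measurable E -> measurable_fun E f -> (forall x, E x -> (0 <= f x)%E) ->
  (\int[normal_prob m s]_(x in E) f x =
   \int[leb]_(x in E) (f x * (normal_pdf m s x)%:E))%E.
Proof.
move=> mE mf f0.
have mfE : measurable_fun setT (f \_ E) by exact/(measurable_restrictT _ _).1.
have dom := normal_prob_dominates m s.
pose rn := Radon_Nikodym_SigmaFinite.f (normal_prob m s) leb.
have rnE : ae_eq leb setT rn (fun x => (normal_pdf m s x)%:E).
  apply: integral_ae_eq => //.
  - exact: Radon_Nikodym_SigmaFinite.f_integrable dom.
  - by apply: measurableT_comp => //; exact: measurable_normal_pdf.
  - by move=> A _ mA; rewrite -Radon_Nikodym_SigmaFinite.f_integral.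
rewrite -{1}(setIid E) integral_mkcondr.
rewrite -(Radon_Nikodym_SigmaFinite.change_of_variables dom)//; last 2 first.
- by move=> x; exact: erestrict_ge0.
- exact: measurable_funTS.
apply: ae_eq_integral => //.
- apply: emeasurable_funM; first exact: measurable_funTS.
  apply: measurable_funTS; apply: measurable_int.
  exact: Radon_Nikodym_SigmaFinite.f_integrable dom.
- apply: emeasurable_funM => //.
  apply/measurable_funTS/measurableT_comp => //.
  exact: measurable_normal_pdf.
- apply: filterS rnE => x /(_ I) rnx Ex.
  by rewrite patchE mem_set// -rnx.
Qed.

Lemma std_normal_pdf_gt0 (x : R) : 0 < std_normal_pdf x.
Proof.
rewrite /std_normal_pdf normal_pdfE ?oner_neq0//.
by rewrite mulr_gt0 ?expR_gt0// normal_peak_gt0 ?oner_neq0.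
Qed.

Lemma std_normal_pdfN (x : R) : std_normal_pdf (- x) = std_normal_pdf x.
Proof. by rewrite /std_normal_pdf normal_pdfN ?oner_neq0// oppr0. Qed.

Lemma normal_prob_oy (m s : R) : 0 < s ->
  normal_prob m s `]0, +oo[ = (std_normal_cdf (m / s))%:E.
Proof.
move=> s0; rewrite -normal_prob_cy// /normal_prob integral_itv_obnd_cbnd//.
by apply/measurable_funTS/measurable_EFinP; exact: measurable_normal_pdf.
Qed.

Lemma normal_prob_Nyc_std (m s : R) : 0 < s ->
  normal_prob m s `]-oo, 0] = (std_normal_cdf (- (m / s)))%:E.
Proof.
by move=> s0; rewrite normal_prob_Nyc ?gt_eqF// normal_prob_cy// mulNr.
Qed.

Lemma integral_cy_id_normal_pdf (m s : R) : 0 < s ->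
  (\int[leb]_(x in `[0%R, +oo[) (x * normal_pdf m s x)%:E =
   (s * std_normal_pdf (m / s) + m * std_normal_cdf (m / s))%:E)%E.
Proof.
move=> s0; rewrite integral_id_normal_pdf_cbnd ?gt_eqF// normal_prob_cy//.
by rewrite sqr_normal_pdf0// -EFinM -EFinD.
Qed.

Lemma normal_pos_part_mean (m s : R) : 0 < s ->
  (\int[normal_prob m s]_(x in `]0%R, +oo[) x%:E =
   (s * std_normal_pdf (m / s) + m * std_normal_cdf (m / s))%:E)%E.
Proof.
move=> s0; rewrite ge0_integral_normal_prob//; last first.
  by move=> x /=; rewrite in_itv/= andbT lee_fin => /ltW.
rewrite integral_itv_obnd_cbnd; last first.
  apply/measurable_funTS/measurable_EFinP/measurable_funM => //.
  exact: measurable_normal_pdf.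
by rewrite -integral_cy_id_normal_pdf.
Qed.

Lemma normal_neg_part_mean (m s : R) : 0 < s ->
  (\int[normal_prob m s]_(x in `]-oo, 0%R]) (- x)%:E =
   (s * std_normal_pdf (m / s) - m * std_normal_cdf (- (m / s)))%:E)%E.
Proof.
move=> s0; rewrite ge0_integral_normal_prob//; last 2 first.
- by apply/measurable_funTS/measurable_EFinP; exact: measurable_funN.
- by move=> x /=; rewrite in_itv/= lee_fin oppr_ge0.
rewrite integral_id_normal_pdf_Nyc ?gt_eqF// integral_cy_id_normal_pdf//.
by rewrite !mulNr std_normal_pdfN.
Qed.

(** If the cumulative distribution function vanished at [x], the law of mean
    [x] and variance 1 would put no mass on the positive half-line, hence have
    no positive part; but the mean of that part is then
    [std_normal_pdf x > 0]. *)
Lemma std_normal_cdf_gt0 (x : R) : 0 < std_normal_cdf x.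
Proof.
have := normal_prob_oy x _ (@ltr01 R); rewrite divr1 => E.
have := normal_pos_part_mean x _ (@ltr01 R); rewrite divr1 mul1r => EM.
have c0 : 0 <= std_normal_cdf x by rewrite -lee_fin -E.
rewrite lt_neqAle c0 andbT; apply/eqP => c00.
move: EM; rewrite -c00 mulr0 addr0 null_set_integral//; last first.
  by rewrite /= E -c00.
by move=> -[] /eqP; rewrite lt_eqF// std_normal_pdf_gt0.
Qed.

Lemma std_normal_cdfN (x : R) : std_normal_cdf x + std_normal_cdf (- x) = 1.
Proof.
have := normal_prob_oy x _ (@ltr01 R); rewrite divr1 => E.
have := normal_prob_Nyc_std x _ (@ltr01 R); rewrite divr1 => E'.
apply: EFin_inj; rewrite EFinD -E -E'.
rewrite -(@probability_setT _ _ _ (normal_prob x 1)) -measureU//.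
- by rewrite setUC -itv_bndbnd_setU// set_itvE.
- apply/seteqP; split => // y [] /=; rewrite !in_itv/= andbT => y0.
  by rewrite leNgt y0.
Qed.

End normal_half_lines.

(** * Integration against independent coordinates *)

Section independence.
Context {d : measure_display} {T : measurableType d} {R : realType}.
Context (P : probability T R).

(** On the event that the other coordinates lie in their ranges, the law of
    [X i] under the restricted measure is its unrestricted law scaled by the
    probability of that event: this is the product rule, read as an identity of
    measures in the range of [X i]. *)
Lemma integral_indep (I : finType) (X : I -> {RV P >-> R}) (A : I -> set R)
    (i : I) (f : R -> \bar R) :
  mutually_independent X -> (forall j, measurable (A j)) ->
  measurable_fun (A i) f -> (forall x, A i x -> (0 <= f x)%E) ->
  (\int[P]_(w in \bigcap_j (X j @^-1` A j)) f (X i w) =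
   (\prod_(j | j != i) P (X j @^-1` A j)) *
   \int[distribution P (X i)]_(x in A i) f x)%E.
Proof.
move=> indX mA mf f0.
have mX j U : measurable U -> measurable (X j @^-1` U).
  by move=> mU; rewrite -[X in measurable X]setTI; exact: measurable_funP.
pose D := \bigcap_(j in [set j | j != i]) X j @^-1` A j.
have mD : measurable D.
  by apply: fin_bigcap_measurable => [|j _]; [exact: finite_finset|exact: mX].
have XAD : \bigcap_j (X j @^-1` A j) = (X i @^-1` A i) `&` D.
  apply/seteqP; split => [w h|w [hi h] j _].
    by split => [|j _]; exact: h.
  by have [->//|ji] := eqVneq j i; exact: h.
have r0 : 0 <= fine (\prod_(j | j != i) P (X j @^-1` A j))%E.
  by apply: fine_ge0; apply: prode_ge0 => j _.
pose r := NngNum r0.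
have rE : (\prod_(j | j != i) P (X j @^-1` A j) = r%:num%:E)%E.
  rewrite /= fineK//; apply: prode_fin_num => j _.
  by apply: fin_num_measure; exact: mX.
have lawE U : measurable U -> U `<=` A i ->
    pushforward (mrestr P mD) (X i) U = mscale r (distribution P (X i)) U.
  move=> mU UA; rewrite /pushforward /mrestr /mscale/= -rE.
  pose A' j := if j == i then U else A j.
  have mA' j : measurable (A' j) by rewrite /A'; case: ifP.
  have -> : X i @^-1` U `&` D =
      \bigcap_(j in [set` [set: I]%SET]) X j @^-1` A' j.
    apply/seteqP; split => [w [Uw Dw] j _|w h].
      rewrite /A' /preimage/=; case: eqVneq => [->|ji]; first exact: Uw.
      exact: (Dw j ji).
    have hA' j : A' j (X j w) by apply: h; rewrite /= finset.in_setT.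
    split; first by have := hA' i; rewrite /A' eqxx.
    by move=> j /= ji; have := hA' j; rewrite /A' (negbTE ji).
  rewrite (indX _ _ mA') (bigD1 i) ?finset.in_setT//= {1}/A' eqxx muleC.
  congr (_ * _)%E; apply: eq_big => [j|j /andP[_ ji]].
    by rewrite finset.in_setT.
  by rewrite /A' (negbTE ji).
rewrite rE -ge0_integral_mscale//.
pose law_on_D := pushforward (mrestr P mD) (X i).
rewrite [RHS](eq_measure_integral law_on_D); last first.
  by move=> U mU UA; apply/esym; exact: lawE.
rewrite ge0_integral_pushforward//; last by move=> y /[!inE]; exact: f0.
rewrite XAD.
have mXA : measurable (X i @^-1` A i) by exact: mX.
have mfX : measurable_fun (X i @^-1` A i) (f \o X i).
  apply: (measurable_comp (mA i) _ mf); last exact: measurable_funTS.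
  by move=> _ [w hw <-].
have fX0 w : (X i @^-1` A i) w -> (0 <= (f \o X i) w)%E by exact: f0.
(* The restricted measure charges only [D], which brings [D] into the domain of
   integration; there it coincides with [P]. *)
have DC0 : mrestr P mD (~` D) = 0%E by rewrite /mrestr setICl measure0.
rewrite [RHS](ge0_negligible_integral (measurableC mD) mXA mfX fX0 DC0).
rewrite setDE setCK.
apply: eq_measure_integral => U mU UD; rewrite /= /mrestr setIidl//.
by apply: subset_trans UD _; exact: subIsetr.
Qed.

(** The law of [X] and [normal_prob] live on two presentations of the Borel
    sigma-algebra of the reals; the identity between them transports
    integrals. *)
Lemma ge0_integral_normal_distribution (m s : R) (X : {RV P >-> R}) (D : set R)
    (f : R -> \bar R) :
  has_normal_distribution m s X -> measurable D -> measurable_fun D f ->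
  (forall x, D x -> (0 <= f x)%E) ->
  (\int[distribution P X]_(x in D) f x = \int[normal_prob m s]_(x in D) f x)%E.
Proof.
move=> lawX mD mf f0; pose id_meas : measurableTypeR R -> R := idfun.
have mid : measurable_fun setT id_meas by move=> _ U mU; rewrite setTI.
transitivity (\int[pushforward (normal_prob m s) id_meas]_(x in D) f x)%E.
  by apply: eq_measure_integral => U mU _; exact: lawX.
by rewrite ge0_integral_pushforward// => x /[!inE]; exact: f0.
Qed.

End independence.

(** * Optimal cut of a weighted sum over voting patterns *)

Section pattern_sums.
Context {R : realFieldType} {n : nat} (p q a b : R).

(** The probability that [S] is the set of supporters, for independent votes. *)
Definition pattern_weight (S : {set 'I_n}) : R :=
  \prod_(j < n) (if j \in S then p else q).

(** What agent [i] gains from accepting the voting pattern [S], when [a] is the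
    mean increment of a supporter and [- b] that of an opponent. *)
Definition pattern_gain (S : {set 'I_n}) (i : 'I_n) : R :=
  (if i \in S then a else - b) * pattern_weight S.

Lemma mem_imset_tperm (i j k : 'I_n) (S : {set 'I_n}) :
  (k \in [set tperm i j x | x in S]%SET) = (tperm i j k \in S).
Proof. by rewrite -{1}(tpermK i j k) mem_imset//; exact: perm_inj. Qed.

(** Exchanging the agents [i] and [j] preserves both the size of a pattern and
    its weight. *)
Lemma sum_pattern_gain_sym (Q : pred nat) (i j : 'I_n) :
  \sum_(S : {set 'I_n} | Q #|S|) pattern_gain S i =
  \sum_(S : {set 'I_n} | Q #|S|) pattern_gain S j.
Proof.
have tK : involutive (fun S : {set 'I_n} => [set tperm i j x | x in S]%SET).
  by move=> S; apply/setP => k; rewrite !mem_imset_tperm tpermK.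
rewrite (reindex_inj (inv_inj tK))/=; apply: eq_big => [S|S _].
  by rewrite card_imset//; exact: perm_inj.
rewrite /pattern_gain mem_imset_tperm tpermL; congr (_ * _).
rewrite /pattern_weight (reindex_inj (@perm_inj _ (tperm i j)))/=.
by apply: eq_bigr => k _; rewrite mem_imset_tperm tpermK.
Qed.

Lemma sum_pattern_gain (S : {set 'I_n}) :
  \sum_i pattern_gain S i = ((a + b) * #|S|%:R - b * n%:R) * pattern_weight S.
Proof.
rewrite -mulr_suml; congr (_ * _).
transitivity (\sum_(i < n) ((a + b) * (i \in S)%:R - b)).
  by apply: eq_bigr => i _; case: (i \in S); rewrite ?mulr1 ?mulr0; ring.
rewrite sumrB -mulr_sumr -natr_sum sumr_const card_ord -[b *+ n]mulr_natr.
congr (_ - _); congr (_ * _%:R); rewrite -sum1_card [RHS]big_mkcond.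
by apply: eq_bigr => i _; case: (i \in S).
Qed.

(** By symmetry the individual sum is the average of the collective gains.
    Since the collective gain of a pattern [S] is a positive multiple of [#|S|
    - n * b / (a + b)], cutting at this zero keeps exactly the patterns with a
    positive contribution. *)
Lemma optimal_cut (c : R) (i : 'I_n) : 0 < p -> 0 < q -> 0 < a + b ->
  \sum_(S : {set 'I_n} | c < #|S|%:R) pattern_gain S i <=
  \sum_(S : {set 'I_n} | b / (a + b) * n%:R < #|S|%:R) pattern_gain S i.
Proof.
move=> p0 q0 ab0.
have n0 : (0 : R) < n%:R by rewrite ltr0n (leq_trans _ (ltn_ord i)).
have average (e : R) :
    n%:R * \sum_(S : {set 'I_n} | e < #|S|%:R) pattern_gain S i =
    \sum_(S : {set 'I_n} | e < #|S|%:R) \sum_j pattern_gain S j.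
  rewrite exchange_big/=; transitivity
    (\sum_(j < n) \sum_(S : {set 'I_n} | e < #|S|%:R) pattern_gain S i).
    by rewrite sumr_const card_ord mulr_natl.
  by apply: eq_bigr => j _; exact: (sum_pattern_gain_sym (fun k => e < k%:R)).
rewrite -(ler_pM2l n0) !average [leLHS]big_mkcond [leRHS]big_mkcond.
apply: ler_sum => S _.
have -> : (b / (a + b) * n%:R < #|S|%:R) = (0 < \sum_j pattern_gain S j).
  rewrite sum_pattern_gain pmulr_lgt0; last first.
    by apply: prodr_gt0 => j _; case: ifP.
  by rewrite subr_gt0 mulrAC ltr_pdivrMr// [X in _ < X]mulrC.
by case: (ltP 0) => h; case: ifP => _ //; exact: ltW.
Qed.

End pattern_sums.

(** * Threshold voting with independent agents *)

Section society.
Context {d : measure_display} {T : measurableType d} {R : realType}.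
Context (P : probability T R) (n : nat) (zeta : 'I_n -> {RV P >-> R}).

Definition vote_range (b : bool) : set R :=
  if b then [set` `]0, +oo[] else [set` `]-oo, 0]].

Definition voting_event (S : {set 'I_n}) : set T :=
  \bigcap_j (zeta j @^-1` vote_range (j \in S)).

Lemma measurable_vote_range b : measurable (vote_range b).
Proof. by case: b => /=; exact: measurable_itv. Qed.

Lemma voting_eventE (S : {set 'I_n}) :
  voting_event S = [set w | supporters (zeta^~ w) = S].
Proof.
apply/seteqP; split => [w h|w <- j _]; last first.
  by rewrite /vote_range /preimage /supporters/= inE; case: ltP => h /=;
    rewrite in_itv/= ?andbT.
apply/setP => j; rewrite inE; have := h j I.
rewrite /vote_range /preimage/=; case: (j \in S) => /=; rewrite in_itv/=.
  by rewrite andbT.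
by rewrite leNgt => /negbTE.
Qed.

Lemma measurable_voting_event (S : {set 'I_n}) : measurable (voting_event S).
Proof.
apply: fin_bigcap_measurable => [|j _]; first exact: finite_finset.
rewrite -[X in measurable X]setTI; apply: measurable_funP => //.
exact: measurable_vote_range.
Qed.

(** The acceptance region is the disjoint union of the voting events of the
    patterns that exceed the threshold. *)
Lemma expectation_actual_increment (alpha : R) (i : 'I_n) :
  ('E_P[actual_increment zeta alpha i] =
   \sum_(S : {set 'I_n} | (alpha * n%:R < #|S|%:R)%R)
     \int[P]_(w in voting_event S) (zeta i w)%:E)%E.
Proof.
pose s := [seq S <- enum {set 'I_n} | (alpha * n%:R < #|S : {set 'I_n}|%:R)%R].
pose D := \big[setU/set0]_(S <- s) voting_event S.
have DE : D = [set w | (alpha * n%:R < #|supporters (zeta^~ w)|%:R)%R].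
  rewrite /D -bigcup_seq.
  apply/seteqP; split => [w [S]|w h].
    by rewrite voting_eventE /= mem_filter => /andP[aS _] ->.
  exists (supporters (zeta^~ w)); rewrite ?voting_eventE//=.
  by rewrite mem_filter h mem_enum.
have -> : ('E_P[actual_increment zeta alpha i] =
    \int[P]_(w in D) (zeta i w)%:E)%E.
  rewrite unlock [RHS]integral_mkcond; apply: eq_integral => w _.
  rewrite patchE DE /actual_increment /acceptance; case: ifPn => h.
    by rewrite mem_set// mulr1.
  by rewrite memNset ?mulr0//; exact/negP.
rewrite integral_bigsetU_EFin.
- by rewrite big_filter big_enum_cond.
- exact: measurable_voting_event.
- by rewrite filter_uniq// enum_uniq.
- by move=> S1 S2 _ _ [w []]; rewrite !voting_eventE/= => -> ->.
- by apply/measurable_funTS/measurable_EFinP.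
Qed.

(** The only features of the law of an agent that the expected increments
    depend on: the probabilities [p], [q] of the two votes, and the conditional
    means [g] and [- l] of the increment given a favourable or an unfavourable
    vote. *)
Definition same_partial_means (p q g l : R) : Prop := forall j,
  [/\ P (zeta j @^-1` vote_range true) = p%:E,
      P (zeta j @^-1` vote_range false) = q%:E,
      (\int[distribution P (zeta j)]_(x in vote_range true) x%:E
        = (p * g)%:E)%E &
      (\int[distribution P (zeta j)]_(x in vote_range false) (- x)%:E
        = (q * l)%:E)%E].

Lemma integral_voting_event (p q g l : R) (S : {set 'I_n}) (i : 'I_n) :
  mutually_independent zeta -> same_partial_means p q g l ->
  (\int[P]_(w in voting_event S) (zeta i w)%:E =
   (pattern_gain p q g l S i)%:E)%E.
Proof.
move=> indep means; have [_ _ gainE lossE] := means i.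
have key (f : R -> \bar R) : measurable_fun (vote_range (i \in S)) f ->
    (forall x, vote_range (i \in S) x -> (0 <= f x)%E) ->
    (\int[P]_(w in voting_event S) f (zeta i w) =
    (\prod_(j < n | j != i) (if j \in S then p else q))%:E *
    \int[distribution P (zeta i)]_(x in vote_range (i \in S)) f x)%E.
  move=> mf f0.
  have mA j : measurable (vote_range (j \in S)) by exact: measurable_vote_range.
  pose A j := vote_range (j \in S).
  rewrite /voting_event (integral_indep _ _ _ A i f indep)//.
  rewrite -prodEFin; congr (_ * _)%E; apply: eq_bigr => j _.
  by rewrite /A; have [Pt Pf _ _] := means j; case: (j \in S).
rewrite /pattern_gain /pattern_weight [X in _ * X](bigD1 i)//= mulrA.
have [iS|iS] := boolP (i \in S).
  rewrite (key EFin) iS.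
  - by rewrite gainE -EFinM; congr EFin; ring.
  - exact/measurable_funTS/measurable_EFinP.
  - by move=> x; rewrite /= in_itv/= andbT lee_fin => /ltW.
under eq_integral do rewrite -[zeta i _]opprK EFinN.
have f0 x : vote_range (i \in S) x -> (0 <= (- x)%:E)%E.
  by rewrite (negbTE iS)/= in_itv/= lee_fin oppr_ge0.
rewrite integral_ge0N; last by move=> w /(_ i I); exact: f0.
rewrite (key (fun x => (- x)%:E))//; last first.
  by apply/measurable_funTS/measurable_EFinP; exact: measurable_funN.
by rewrite (negbTE iS) lossE -EFinM -EFinN; congr EFin; ring.
Qed.

(** The law of the agents enters the optimal threshold only through the ratio
    of the mean loss of an opponent to the sum of the mean gain of a supporter
    and that mean loss. *)
Lemma partial_means_optimal_threshold (p q g l : R) :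
  (0 < n)%N -> mutually_independent zeta -> same_partial_means p q g l ->
  0 < p -> 0 < q -> 0 < g + l ->
  optimal_threshold zeta (l / (g + l)).
Proof.
move=> n0 indep means p0 q0 gl0.
have [_ _ gainE lossE] := means (Ordinal n0).
have g0 : 0 <= g.
  rewrite -(pmulr_rge0 _ p0) -lee_fin -gainE; apply: integral_ge0 => x.
  by rewrite /= in_itv/= andbT lee_fin => /ltW.
have l0 : 0 <= l.
  rewrite -(pmulr_rge0 _ q0) -lee_fin -lossE; apply: integral_ge0 => x.
  by rewrite /= in_itv/= lee_fin oppr_ge0.
split.
  apply/andP; split; last by rewrite ler_pdivrMr// mul1r lerDr.
  apply: (@le_trans _ _ 0); first by rewrite oppr_le0 invr_ge0.
  by rewrite divr_ge0// ltW.
move=> alpha _ i; rewrite !expectation_actual_increment.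
under eq_bigr do rewrite (integral_voting_event _ _ _ _ _ _ indep means).
under [leRHS]eq_bigr do
  rewrite (integral_voting_event _ _ _ _ _ _ indep means).
by rewrite !sumEFin lee_fin optimal_cut.
Qed.

End society.

Theorem corollary4 (R : realType) (d : measure_display) (T : measurableType d)
    (P : probability T R) (n : nat) (mu sigma : R)
    (zeta : 'I_n -> {RV P >-> R})
    (n_ge1 : (1 <= n)%N) (sigma_gt0 : 0 < sigma)
    (zeta_indep : mutually_independent zeta)
    (zeta_normal : forall i : 'I_n, has_normal_distribution mu sigma (zeta i)) :
  let rho := mu / sigma in
  optimal_threshold zeta
    (std_normal_cdf rho *
       (1 - rho * std_normal_cdf (- rho) / std_normal_pdf rho)).
Proof.
move=> rho.
have p0 := std_normal_cdf_gt0 rho; have q0 := std_normal_cdf_gt0 (- rho).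
have f0 := std_normal_pdf_gt0 rho; have pq1 := std_normal_cdfN rho.
set p := std_normal_cdf rho in p0 pq1 *.
set q := std_normal_cdf (- rho) in q0 pq1 *.
set f := std_normal_pdf rho in f0 *.
(* The means [g] and [- l] of an increment conditioned on its sign. *)
pose g := (sigma * f + mu * p) / p; pose l := (sigma * f - mu * q) / q.
have glE : g + l = sigma * f / (p * q).
  rewrite /g /l; have -> : q = 1 - p by lra.
  by field; apply/andP; split; apply/eqP; lra.
have -> : p * (1 - rho * q / f) = l / (g + l).
  by rewrite glE /l /rho; field; rewrite !gt_eqF.
apply: (@partial_means_optimal_threshold _ _ _ _ _ _ p q) => //; last first.
  by rewrite glE divr_gt0 ?mulr_gt0.
move=> j; split.
- rewrite -[LHS]/(distribution P (zeta j) _) zeta_normal.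
    exact: normal_prob_oy.
  exact: measurable_vote_range.
- rewrite -[LHS]/(distribution P (zeta j) _) zeta_normal.
    exact: normal_prob_Nyc_std.
  exact: measurable_vote_range.
- rewrite (ge0_integral_normal_distribution _ _ _ _ _ _ (zeta_normal j))//.
  + by rewrite /= normal_pos_part_mean// /g [p * _]mulrC divfK// gt_eqF.
  + exact: measurable_vote_range.
  + by move=> x; rewrite /= in_itv/= andbT lee_fin => /ltW.
- rewrite (ge0_integral_normal_distribution _ _ _ _ _ _ (zeta_normal j))//.
  + by rewrite /= normal_neg_part_mean// /l [q * _]mulrC divfK// gt_eqF.
  + exact: measurable_vote_range.
  + by apply/measurable_funTS/measurable_EFinP; exact: measurable_funN.
  + by move=> x; rewrite /= in_itv/= lee_fin oppr_ge0.
Qed.
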